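(* Let $A,B,C$ be real constants with $B\neq 0$, let $I\subseteq\mathbb{R}$ be an open interval, and let $W_{\mathcal{LT}}:I\to\mathbb{R}$ be a differentiable function such that for every $x\in I$ we have $B\,W_{\mathcal{LT}}(x)>0$ and $$\bigl(A\,W_{\mathcal{LT}}(x)\ln(B\,W_{\mathcal{LT}}(x))+W_{\mathcal{LT}}(x)+C\bigr)e^{W_{\mathcal{LT}}(x)}=x .$$ Then for every $x\in I$, $$\frac{dW_{\mathcal{LT}}(x)}{dx}=\frac{e^{-W_{\mathcal{LT}}(x)}}{[W_{\mathcal{LT}}(x)+1]\,A\ln\bigl(BW_{\mathcal{LT}}(x)\bigr)+W_{\mathcal{LT}}(x)+A+C+1}.$$
   Context: For real constants $A,B,C$, the translated logarithmic Lambert function $W_{\mathcal{LT}}(x)$ is defined as a solution $y$ (necessarily with $By>0$, so $y\neq0$) of the equation $(Ay\ln(By)+y+C)e^y=x$. *)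

(* Defs.v *)
From Stdlib Require Export Reals.
From Coquelicot Require Export Coquelicot.

(* Main.v *)
Require Import Defs.
From Stdlib Require Import Reals Lra.
From Coquelicot Require Import Coquelicot.
Open Scope R_scope.

(** The function [W] is a right inverse of g(y) = (A y ln(By) + y + C) e^y, whose derivative is D(y)
    e^y with D the denominator of the claim. Differentiating g(W(x)) = x by the chain rule gives
    W'(x) D(W(x)) e^(W(x)) = 1. This yields the formula and also shows that D does not vanish, which
    is stated separately since division in Rocq is total. *)

Lemma is_derive_defining_function (A B C y : R) (hy : 0 < B * y) :
  is_derive (fun y => (A * y * ln (B * y) + y + C) * exp y) y
    (((y + 1) * A * ln (B * y) + y + A + C + 1) * exp y).
Proof.
  (* Both factors must be nonzero for [field] to cancel [B * y] in the derivative of the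
     logarithm. *)
  assert (hB : B <> 0) by (intros ->; lra).
  assert (hy0 : y <> 0) by (intros ->; lra).
  auto_derive; [easy | now field].
Qed.

Theorem theorem1 (A B C : R) (hB : B <> 0) (a b : Rbar) (W : R -> R)
    (hdiff : forall x : R, Rbar_lt a x -> Rbar_lt x b -> ex_derive W x)
    (hpos : forall x : R, Rbar_lt a x -> Rbar_lt x b -> 0 < B * W x)
    (heq : forall x : R, Rbar_lt a x -> Rbar_lt x b ->
      (A * W x * ln (B * W x) + W x + C) * exp (W x) = x) :
  forall x : R, Rbar_lt a x -> Rbar_lt x b ->
    (W x + 1) * A * ln (B * W x) + W x + A + C + 1 <> 0 /\
    Derive W x =
      exp (- W x) / ((W x + 1) * A * ln (B * W x) + W x + A + C + 1).
Proof.
  intros x hax hxb.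
  set (D := (W x + 1) * A * ln (B * W x) + W x + A + C + 1).
  assert (hchain : Derive W x * (D * exp (W x)) = 1).
  { assert (hcomp := is_derive_comp _ _ _ _ _
      (is_derive_defining_function A B C (W x) (hpos x hax hxb))
      (Derive_correct W x (hdiff x hax hxb))).
    assert (hid : is_derive
      (fun t => (A * W t * ln (B * W t) + W t + C) * exp (W t)) x 1).
    (* The composite agrees with the identity only on the interval; being open, it is a
       neighbourhood of [x], which is enough for the derivative. *)
    { apply is_derive_ext_loc with (f := fun t : R => t).
      - assert (hI : locally x (fun t : R => Rbar_lt a t /\ Rbar_lt t b)).
        { apply filter_and;
            [now apply (open_Rbar_gt' x) | now apply (open_Rbar_lt' x)]. }
        revert hI; apply filter_imp; intros t [hat htb].
        symmetry; now apply heq.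
      - apply (is_derive_id (K := R_AbsRing)). }
    apply is_derive_unique in hcomp, hid.
    now rewrite <- hid, hcomp. }
  (* A vanishing [D] would turn the chain rule identity into 0 = 1. *)
  assert (hD : D <> 0) by (intros h0; rewrite h0 in hchain; lra).
  split; [exact hD |].
  assert (hexp := exp_pos (W x)).
  rewrite exp_Ropp.
  apply Rmult_eq_reg_r with (D * exp (W x)).
  - rewrite hchain; field; split; lra.
  - apply Rmult_integral_contrapositive; split; lra.
Qed.
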